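(* Let $G$ be a simple connected graph with $n$ vertices, and let $G^*$ be its double graph. Then \[ C^\xi(G^* ) = 4\,C^\xi(G) - 2(n-1)\,\|n-1\|_G, \] where $\|n-1\|_G$ denotes the number of vertices of $G$ of degree $n-1$ (equivalently, of eccentricity one).
   Context: For a connected graph $H$, $d_H(v)$ is the degree of $v$ and the eccentricity $\varepsilon_H(v)$ is the largest distance from $v$ to any other vertex of $H$. The connective eccentric index is $C^\xi(H)=\sum_{v\in V(H)} \frac{d_H(v)}{\varepsilon_H(v)}$. The double graph $G^*$ of a graph $G$ with $V(G)=\{v_1,\dots,v_n\}$ has vertex set $X\cup Y$, $X=\{x_1,\dots,x_n\}$, $Y=\{y_1,\dots,y_n\}$; its edges are $x_ix_j$ and $y_iy_j$ for every edge $v_iv_j\in E(G)$ (two copies of $G$), together with the two edges $x_iy_j$ and $x_jy_i$ for every edge $v_iv_j\in E(G)$. *)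

(* Defs.v *)
From mathcomp Require Import all_boot all_order all_algebra.

Set Implicit Arguments.
Unset Strict Implicit.
Unset Printing Implicit Defensive.

Import GRing.Theory.

Record sgraph := SGraph {
  vertex :> finType;
  adj : rel vertex;
  adj_sym : symmetric adj;
  adj_irrefl : irreflexive adj
}.

Definition connected (G : sgraph) : Prop :=
  0 < #|G| /\ forall u v : G, connect (@adj G) u v.

Definition degree (G : sgraph) (v : G) : nat := #|[set u : G | adj v u]|.

Definition has_walk (G : sgraph) (k : nat) (u v : G) : bool :=
  [exists p : k.-tuple G, path (@adj G) u p && (last u p == v)].

(* A shortest walk has fewer than #|G| edges, so bounding k loses nothing.    *)
(* Vertices in distinct components get the junk value #|G|.                   *)
Definition dist (G : sgraph) (u v : G) : nat :=
  \big[minn/#|G|]_(k < #|G| | has_walk k u v) k.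

Definition eccentricity (G : sgraph) (v : G) : nat :=
  \max_(u : G | u != v) dist v u.

(* Since x / 0 = 0 in rat, the vertex of the one-vertex graph (eccentricity   *)
(* 0, degree 0) contributes 0.                                                *)
Definition connective_eccentric_index (G : sgraph) : rat :=
  (\sum_(v : G) (degree v)%:R / (eccentricity v)%:R)%R.

Definition num_of_degree (G : sgraph) (k : nat) : nat :=
  #|[set v : G | degree v == k]|.

Section DoubleGraph.
Variable G : sgraph.

(* inl v and inr v are the copies of v in X and in Y. *)
Definition double_adj (a b : G + G) : bool :=
  match a, b with
  | inl u, inl v => adj u v
  | inr u, inr v => adj u v
  | inl u, inr v => adj u v
  | inr u, inl v => adj u v
  end.

Lemma double_adj_sym : symmetric double_adj.
Proof. by move=> [u|u] [v|v] /=; rewrite adj_sym. Qed.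

Lemma double_adj_irrefl : irreflexive double_adj.
Proof. by move=> [u|u] /=; rewrite adj_irrefl. Qed.

Definition double_graph : sgraph :=
  @SGraph (G + G)%type double_adj double_adj_sym double_adj_irrefl.

End DoubleGraph.

(* Main.v *)
(** Forgetting the copy, [double_proj] maps edges of [G*] to edges of [G], and
    every walk of positive length in [G] lifts to [G*] with arbitrarily chosen
    copies of its end points.  Hence distances between vertices over distinct
    vertices of [G] are preserved, while the two copies of a non-isolated vertex
    are at distance 2.  So degrees double and eccentricities become
    [max 2 eps]: the summand [d/eps] of [v] becomes two summands [2d/eps],
    except when [eps = 1], i.e. [d = n - 1], where each of them is [(n - 1)]
    instead of [2 (n - 1)]. *)
Require Import Defs.
From mathcomp Require Import all_boot all_order all_algebra.
From mathcomp Require Import ring.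

Set Implicit Arguments.
Unset Strict Implicit.
Unset Printing Implicit Defensive.

Import GRing.Theory.

Section Distance.
Variable G : sgraph.
Implicit Types (u v : G) (k m : nat) (p : seq G).

Lemma has_walkP k u v :
  reflect (exists p, [/\ size p = k, path (@adj G) u p & last u p = v])
          (has_walk k u v).
Proof.
apply: (iffP existsP) => [[p /andP[up /eqP lp]]|[p [sp up lp]]].
  by exists p; rewrite size_tuple.
by exists (tcast sp (in_tuple p)); rewrite val_tcast up lp eqxx.
Qed.

Lemma has_walk0 u v : has_walk 0 u v = (u == v).
Proof.
apply/has_walkP/eqP => [[p [/size0nil -> //]]|<-]; by exists [::].
Qed.

Lemma has_walk1 u v : has_walk 1 u v = adj u v.
Proof.
apply/has_walkP/idP => [[[|w [|? ?]] [//= _ /andP[uw _] <- //]]|uv].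
by exists [:: v]; rewrite /= uv.
Qed.

Lemma has_walkS k u v :
  has_walk k.+1 u v = [exists w, adj u w && has_walk k w v].
Proof.
apply/has_walkP/existsP => [[[|w p] [//= [sp] /andP[uw wp] lp]]|].
  by exists w; rewrite uw; apply/has_walkP; exists p.
move=> [w /andP[uw /has_walkP[p [sp wp lp]]]].
by exists (w :: p); rewrite /= sp uw.
Qed.

Lemma leq_dist_card u v : dist u v <= #|G|.
Proof.
by rewrite /dist; elim/big_rec: _ => // k x _ lex; apply: leq_trans (geq_minr _ _) _.
Qed.

Lemma dist_leq k u v : has_walk k u v -> dist u v <= k.
Proof.
(* Lengths from [#|G|] on lie outside the range of the minimum, but its default value [#|G|] bounds
   it anyway. *)
move=> kuv; have [ltk|] := ltnP k #|G|; last exact: leq_trans (leq_dist_card u v).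
have: Ordinal ltk \in index_enum 'I_#|G| by rewrite mem_index_enum.
rewrite /dist; elim: (index_enum _) => // i s IHs; rewrite inE big_cons.
case/orP => [/eqP <- /=|/IHs les]; first by rewrite kuv geq_minl.
by case: ifP => // _; apply: leq_trans (geq_minr _ _) les.
Qed.

(** The premise [m <= #|G|] takes care of the default value of the minimum. *)
Lemma leq_dist m u v :
  m <= #|G| -> (forall k, has_walk k u v -> m <= k) -> m <= dist u v.
Proof.
move=> lem H; rewrite /dist; elim/big_ind: _ => // [x y|i /H //].
by rewrite leq_min => -> ->.
Qed.

(** Removing repeated vertices leaves a walk with fewer than [#|G|] edges, so the minimum lies below
    its default value and is attained by an actual walk length. *)
Lemma has_walk_dist u v : connect (@adj G) u v -> has_walk (dist u v) u v.
Proof.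
case/connectP => p up ->; case/shortenP: up => q uq Uq _.
have ltd : dist u (last u q) < #|G|.
  apply: (@leq_ltn_trans (size q)).
    by apply: dist_leq; apply/has_walkP; exists q.
  by rewrite -[_.+1]/(size (u :: q)) -(card_uniqP Uq) max_card.
have: dist u (last u q) = #|G| \/ has_walk (dist u (last u q)) u (last u q).
  rewrite {1 2}/dist; elim/big_ind: _ => [|x y|i]; [by left| |by right].
  by rewrite /minn; case: ltnP.
by case=> // E; rewrite E ltnn in ltd.
Qed.

Lemma dist_gt0 u v : u != v -> 0 < dist u v.
Proof.
move=> uv; apply: leq_dist => [|[|//]]; first by apply/card_gt0P; exists u.
by rewrite has_walk0 (negPf uv).
Qed.

Lemma leq_dist_ecc u v : v != u -> dist u v <= eccentricity u.
Proof. exact: (@leq_bigmax_cond _ (fun w => w != u) (dist u)). Qed.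

Lemma degree_gt0 v : connected G -> 1 < #|G| -> 0 < degree v.
Proof.
move=> [_ conn] /card_gt1P[a [b [_ _ ab]]].
have [w wv]: exists w, w != v.
  by have [av|av] := eqVneq a v; [exists b; rewrite -av eq_sym | exists a].
have := has_walk_dist (conn v w); case: (dist v w) => [|k].
  by rewrite has_walk0 eq_sym (negPf wv).
rewrite has_walkS => /existsP[x /andP[vx _]].
by apply/card_gt0P; exists x; rewrite inE.
Qed.

Lemma eccentricity_gt0 v : connected G -> 1 < #|G| -> 0 < eccentricity v.
Proof.
move=> Gc ltG; have /card_gt0P[u] := degree_gt0 v Gc ltG; rewrite inE => vu.
have uv : u != v by apply: contraTneq vu => ->; rewrite adj_irrefl.
by apply: leq_trans (leq_dist_ecc uv); rewrite dist_gt0 // eq_sym.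
Qed.

(** Both equalities say that the neighbourhood of [v] fills [[set~ v]]. A single vertex is excluded
    because its degree is [#|G| - 1 = 0] while its eccentricity is 0. *)
Lemma degree_eq_ecc v : connected G -> 1 < #|G| ->
  (degree v == #|G| - 1) = (eccentricity v == 1).
Proof.
move=> Gc ltG; have [_ conn] := Gc.
have -> : #|G| - 1 = #|[set~ v]| by rewrite cardsC1 subn1.
have subv : [set u | adj v u] \subset [set~ v].
  by apply/subsetP => u; rewrite !inE; apply: contraTneq => ->; rewrite adj_irrefl.
rewrite /degree eqn_leq subset_leq_card //= [RHS]eqn_leq eccentricity_gt0 // andbT.
apply/idP/idP => [ge|le1].
  have /eqP E : [set u | adj v u] == [set~ v] by rewrite eqEcard subv.
  apply/bigmax_leqP => u uv; apply: dist_leq; rewrite has_walk1.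
  by have: u \in [set~ v]; [rewrite !inE | rewrite -E inE].
apply/subset_leq_card/subsetP => u; rewrite !inE => uv.
have := leq_trans (leq_dist_ecc uv) le1.
have := has_walk_dist (conn v u); have := dist_gt0 (v := u) (u := v).
rewrite eq_sym => /(_ uv); case: (dist v u) => [|[|//]] // _.
by rewrite has_walk1.
Qed.

End Distance.

Section Double.
Variable G : sgraph.
Implicit Types (a b c : double_graph G) (u v : G).

Definition double_proj (a : double_graph G) : G :=
  match a with inl v => v | inr v => v end.

Lemma adj_double a b : adj a b = adj (double_proj a) (double_proj b).
Proof. by case: a b => [u|u] [v|v]. Qed.

Lemma double_proj_inl v : double_proj (inl v : double_graph G) = v.
Proof. by []. Qed.

(** Length 0 is left out because the two copies of a vertex have equal projections but are not
    joined by an empty walk. *)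
Lemma has_walk_double k a b :
  has_walk k.+1 a b = has_walk k.+1 (double_proj a) (double_proj b).
Proof.
elim: k a => [|k IHk] a; first by rewrite !has_walk1 adj_double.
rewrite [LHS]has_walkS [RHS]has_walkS.
apply/existsP/existsP => [[c]|[w]] /andP[ac cb].
  by exists (double_proj c); rewrite -adj_double ac -IHk.
(* Adjacency ignores copies, so either copy of the intermediate vertex would do. *)
by exists (inl w); rewrite adj_double IHk ac.
Qed.

Lemma card_double : #|double_graph G| = #|G| + #|G|.
Proof. by rewrite card_sum. Qed.

Lemma dist_double a b : connect (@adj G) (double_proj a) (double_proj b) ->
  double_proj a != double_proj b ->
  dist a b = dist (double_proj a) (double_proj b).
Proof.
move=> /has_walk_dist wab neq; have := dist_gt0 neq => d0.
apply/eqP; rewrite eqn_leq; apply/andP; split.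
  by apply: dist_leq; move: wab d0; case: (dist _ _) => // k; rewrite has_walk_double.
apply: leq_dist => [|[|k]].
- by rewrite card_double (leq_trans (leq_dist_card _ _)) ?leq_addr.
- by rewrite has_walk0 => /eqP E; rewrite E eqxx in neq.
- by rewrite has_walk_double; apply: dist_leq.
Qed.

(** A common neighbour gives a walk of length 2; length 1 would need a loop in [G]. *)
Lemma dist_double_twin a b : 0 < degree (double_proj a) -> a != b ->
  double_proj a = double_proj b -> dist a b = 2.
Proof.
move=> /card_gt0P[w]; rewrite inE => aw ab E; apply/eqP; rewrite eqn_leq.
apply/andP; split.
  apply: dist_leq; rewrite has_walk_double has_walkS; apply/existsP; exists w.
  by rewrite aw has_walk1 -E adj_sym.
apply: leq_dist => [|[|[|//]]].
- have : 0 < #|G| by apply/card_gt0P; exists w.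
  by rewrite card_double; case: #|G| => // m _; rewrite addSn addnS.
- by rewrite has_walk0 (negPf ab).
- by rewrite has_walk_double has_walk1 E adj_irrefl.
Qed.

Lemma degree_double a : degree a = 2 * degree (double_proj a).
Proof.
rewrite /degree -!sum1dep_card big_sumType /= mul2n -addnn.
by case: a => u.
Qed.

Lemma eccentricity_double a : connected G -> 1 < #|G| ->
  eccentricity a = maxn 2 (eccentricity (double_proj a)).
Proof.
move=> Gc ltG; have [_ conn] := Gc; have deg0 := degree_gt0 (double_proj a) Gc ltG.
apply/eqP; rewrite eqn_leq geq_max; apply/and3P; split.
- apply/bigmax_leqP => b ba; rewrite leq_max.
  have [E|neq] := eqVneq (double_proj a) (double_proj b).
    by rewrite (dist_double_twin deg0) // eq_sym.
  by rewrite dist_double // leq_dist_ecc ?orbT // eq_sym.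
(* The bound 2 comes from the other copy of the same vertex. *)
- have [b ba E]: exists2 b, b != a & double_proj a = double_proj b.
    by case: (a) => v; [exists (inr v) | exists (inl v)].
  rewrite -(dist_double_twin deg0 (b := b)) ?leq_dist_ecc //.
  by rewrite eq_sym.
- apply/bigmax_leqP => u ua.
  have au : inl u != a by apply: contraNneq ua => <-.
  rewrite -[u]double_proj_inl -dist_double ?leq_dist_ecc //=.
  by rewrite eq_sym.
Qed.

End Double.

Theorem theorem1 (G : sgraph) (n : nat) (Gconn : connected G) (Gn : #|G| = n) :
  (connective_eccentric_index (double_graph G) =
     4 * connective_eccentric_index G
     - 2 * (n%:R - 1) * (num_of_degree G (n - 1))%:R)%R.
Proof.
subst n; rewrite /connective_eccentric_index big_sumType /=.
(* For a single vertex both indices vanish with the degrees, and the correction vanishes with its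
   factor [n - 1]. *)
have [leG|ltG] := leqP #|G| 1.
  have G1 : #|G| = 1 by apply/eqP; rewrite eqn_leq leG; case: Gconn.
  have deg0 (v : G) : degree v = 0.
    apply/eqP; rewrite cards_eq0; apply/eqP/setP => u; rewrite !inE.
    by rewrite (fintype_le1P leG u v) adj_irrefl.
  rewrite G1 subrr mulr0 mul0r subr0.
  by rewrite !big1 ?mulr0 ?addr0 // => v _; rewrite ?degree_double ?deg0 mul0r.
(* The two copies of [v] contribute equally, hence [*+ 2]; the indicator marks the vertices where
   the maximum with 2 changes the eccentricity. *)
have term (v : G) : ((2 * degree v)%:R / (maxn 2 (eccentricity v))%:R *+ 2
    = 4 * ((degree v)%:R / (eccentricity v)%:R)
      - 2 * (#|G|%:R - 1) * (degree v == #|G| - 1)%N%:R :> rat)%R.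
  have := degree_eq_ecc v Gconn ltG; case: eqP => [-> /esym/eqP ->|_ /esym ne1].
    rewrite natrM natrB ?(ltnW ltG) //=.
    have -> : maxn 2 1 = 2 by [].
    by field.
  have -> : maxn 2 (eccentricity v) = eccentricity v.
    apply/maxn_idPr; rewrite ltn_neqAle eq_sym ne1.
    exact: eccentricity_gt0.
  by rewrite natrM mulr0 subr0; ring.
(* The count becomes a sum of indicators over all vertices, so that the two sides can be compared
   term by term. *)
rewrite /num_of_degree -sum1dep_card natr_sum [X in (_ - _ * X)%R]big_mkcond.
rewrite -big_split !mulr_sumr -sumrB; apply: eq_bigr => v _ /=.
rewrite !degree_double !eccentricity_double //= -mulr2n term.
by case: eqP.
Qed.
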